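(* Let $U\in C^1([0,T];\mathbb{R}^N)$ and $q_1,q_2\in C^1([0,T];\mathbb{R})$ be a solution of the semi-discrete system $$\begin{aligned} &\frac{d}{dt}U=D\Bigg(-\frac{g_1(U,D_1U)-D_1g_2(U,D_1U)}{2\sqrt{\langle g(U,D_1U),\mathbf{1}\rangle_h+C_1}}\,q_1+\frac{h_1(U,D_1U)-D_1h_2(U,D_1U)}{2\sqrt{\langle h(U,D_1U),\mathbf{1}\rangle_h+C_2}}\,q_2+\frac14(U-D_2U)\Bigg),\\ &\frac{d}{dt}q_1=\Bigg\langle\frac{g_1(U,D_1U)-D_1g_2(U,D_1U)}{2\sqrt{\langle g(U,D_1U),\mathbf{1}\rangle_h+C_1}},\frac{d}{dt}U\Bigg\rangle_h,\\ &\frac{d}{dt}q_2=\Bigg\langle\frac{h_1(U,D_1U)-D_1h_2(U,D_1U)}{2\sqrt{\langle h(U,D_1U),\mathbf{1}\rangle_h+C_2}},\frac{d}{dt}U\Bigg\rangle_h . \end{aligned}$$ Then the semi-discrete modified energy $$E_h=\frac18\langle U-D_2U,U\rangle_h-\frac12q_1^2+\frac12q_2^2+\frac12C_1-\frac12C_2$$ satisfies $\frac{d}{dt}E_h=0$ on $[0,T]$.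
   Context: Let $a<b$, $L=b-a$, $\mu=2\pi/L$, $N$ an even positive integer, $\Delta x=L/N$, and $x_j=j\,\Delta x$. Vectors in $\mathbb{R}^N$ are indexed by $j=0,\dots,N-1$; $\mathbf{1}=(1,\dots,1)^T\in\mathbb{R}^N$; the discrete inner product is $\langle U,V\rangle_h=\Delta x\sum_{j=0}^{N-1}U_jV_j$ (the subscript $h$ is only a label referring to the mesh size). The Fourier pseudo-spectral differentiation matrices $D_1,D_2\in\mathbb{R}^{N\times N}$ are $$(D_1)_{j,l}=\begin{cases}\frac12\mu(-1)^{j+l}\cot\big(\mu\frac{x_j-x_l}{2}\big),&j\ne l,\\0,&j=l,\end{cases}\qquad (D_2)_{j,l}=\begin{cases}\frac12\mu^2(-1)^{j+l+1}\csc^2\big(\mu\frac{x_j-x_l}{2}\big),&j\neq l,\\-\mu^2\frac{N^2+2}{12},&j=l.\end{cases}$$ Equivalently, $D_k=F_N^H\Lambda_kF_N$ with $(F_N)_{j,k}=\frac1{\sqrt N}e^{-\mathrm{i}jk2\pi/N}$, $\Lambda_1=\mathrm{i}\mu\,\mathrm{diag}[0,1,\dots,\frac N2-1,0,1-\frac N2,\dots,-1]$, $\Lambda_2=-\mu^2\,\mathrm{diag}[0^2,1^2,\dots,(\frac N2)^2,(-\frac N2+1)^2,\dots,(-1)^2]$. Set $D=(I-D_2)^{-1}D_1$, with $I$ the identity matrix. The scalar functions, applied componentwise to pairs of vectors, are $$g(u,v)=(u+\tfrac12)^2(u^2+v^2),\quad g_1(u,v)=\tfrac{\partial g}{\partial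 u}=2(u+\tfrac12)(2u^2+v^2+\tfrac12u),\quad g_2(u,v)=\tfrac{\partial g}{\partial v}=2v(u+\tfrac12)^2,$$ $$h(u,v)=u^2(u^2+v^2),\quad h_1(u,v)=\tfrac{\partial h}{\partial u}=4u^3+2uv^2,\quad h_2(u,v)=\tfrac{\partial h}{\partial v}=2vu^2.$$ $C_1,C_2$ are real constants large enough that the quantities under the square roots are positive for all $t\in[0,T]$. *)

(* Defs.v *)
From HB Require Import structures.
From mathcomp Require Import all_boot all_order all_algebra.
From mathcomp Require Import ring lra.
From mathcomp Require Import all_classical all_reals all_analysis.

Set Implicit Arguments.
Unset Strict Implicit.
Unset Printing Implicit Defensive.

Import Order.TTheory GRing.Theory Num.Theory.
Import numFieldNormedType.Exports.

Local Open Scope classical_set_scope.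
Local Open Scope ring_scope.

(* Derivative at t relative to a set A: only points s of A are used, so on
   A = `[0, T] it is the usual derivative inside and the one-sided derivative
   at the endpoints. *)
Section DerivativeOnASet.
Variables (R : realType) (V : normedModType R).
Implicit Types (A : set R) (f : R -> V) (t s : R).

Definition diff_quotient f t s : V := (s - t)^-1 *: (f s - f t).

Definition derivable_on A f t : Prop :=
  cvg (diff_quotient f t s @[s --> within A t^']).

Definition deriv_on A f t : V :=
  lim (diff_quotient f t s @[s --> within A t^']).

Definition continuously_derivable_on A f : Prop :=
  (forall t, A t -> derivable_on A f t) /\ {within A, continuous (deriv_on A f)}.

End DerivativeOnASet.

Section FourierPseudoSpectral.
Variables (R : realType).

Definition cot (x : R) : R := cos x / sin x.
Definition csc (x : R) : R := (sin x)^-1.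

Variables (a b : R) (N : nat).

Definition mu : R := 2 * pi / (b - a).
Definition dx : R := (b - a) / N%:R.
Definition node (j : nat) : R := j%:R * dx.

Definition inner (U V : 'cV[R]_N) : R := dx * \sum_(j < N) U j 0 * V j 0.

Definition D1 : 'M[R]_N :=
  \matrix_(j, l)
    if j == l then 0
    else 2^-1 * mu * (-1) ^+ (j + l) * cot (mu * ((node j - node l) / 2)).

Definition D2 : 'M[R]_N :=
  \matrix_(j, l)
    if j == l then - (mu ^+ 2 * ((N%:R ^+ 2 + 2) / 12))
    else 2^-1 * mu ^+ 2 * (-1) ^+ (j + l + 1)
         * csc (mu * ((node j - node l) / 2)) ^+ 2.

Definition D : 'M[R]_N := invmx (1%:M - D2) *m D1.

End FourierPseudoSpectral.

Section Nonlinearities.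
Variable R : realType.
Implicit Types u v : R.

Definition g u v : R := (u + 2^-1) ^+ 2 * (u ^+ 2 + v ^+ 2).
Definition g1 u v : R :=
  2 * (u + 2^-1) * (2 * u ^+ 2 + v ^+ 2 + 2^-1 * u).
Definition g2 u v : R := 2 * v * (u + 2^-1) ^+ 2.

Definition h u v : R := u ^+ 2 * (u ^+ 2 + v ^+ 2).
Definition h1 u v : R := 4 * u ^+ 3 + 2 * u * v ^+ 2.
Definition h2 u v : R := 2 * v * u ^+ 2.

Lemma g1E u v : is_derive u 1 (g ^~ v) (g1 u v).
Proof. by apply: is_derive_eq; rewrite /g1 /GRing.scale /=; field. Qed.

Lemma g2E u v : is_derive v 1 (g u) (g2 u v).
Proof. by apply: is_derive_eq; rewrite /g2 /GRing.scale /=; field. Qed.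

Lemma h1E u v : is_derive u 1 (h ^~ v) (h1 u v).
Proof. by apply: is_derive_eq; rewrite /h1 /GRing.scale /=; ring. Qed.

Lemma h2E u v : is_derive v 1 (h u) (h2 u v).
Proof. by apply: is_derive_eq; rewrite /h2 /GRing.scale /=; ring. Qed.

End Nonlinearities.

Arguments g {R} u v.
Arguments g1 {R} u v.
Arguments g2 {R} u v.
Arguments h {R} u v.
Arguments h1 {R} u v.
Arguments h2 {R} u v.

Section SemiDiscreteSystem.
Variables (R : realType) (a b : R) (N : nat).
Implicit Types (f : R -> R -> R) (C : R) (U : 'cV[R]_N).

(* <f(U, D1 U), 1>_h + C *)
Definition radicand f C U : R :=
  inner a b (map2_mx f U (D1 a b N *m U)) (const_mx 1) + C.

(* (f1(U, D1 U) - D1 f2(U, D1 U)) / (2 sqrt(<f(U, D1 U), 1>_h + C)), where f1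
   and f2 are the partial derivatives of f *)
Definition sav_gradient f f1 f2 C U : 'cV[R]_N :=
  (2 * Num.sqrt (radicand f C U))^-1 *:
    (map2_mx f1 U (D1 a b N *m U) - D1 a b N *m map2_mx f2 U (D1 a b N *m U)).

Definition energy C1 C2 U (q1 q2 : R) : R :=
  8^-1 * inner a b (U - D2 a b N *m U) U - 2^-1 * q1 ^+ 2 + 2^-1 * q2 ^+ 2
  + 2^-1 * C1 - 2^-1 * C2.

End SemiDiscreteSystem.

(* Main.v *)
(* The energy is a quadratic form in (U, q1, q2), so by the symmetry of D2 its
   difference quotient is a bilinear form in the sum and the difference quotient
   of the unknowns; in the limit, the equations for q1 and q2 give
   dE/dt = <G, dU/dt> with dU/dt = D G. It remains to see that D is
   skew-symmetric. Since N is even, the entries of D1 and D2 depend only on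
   j - l modulo N, so D1 and D2 are circulant and commute; D1 is skew-symmetric
   and commutes with the symmetric matrix (I - D2)^-1, so their product D is
   skew-symmetric. *)
Require Import Defs.
From HB Require Import structures.
From mathcomp Require Import all_boot all_order all_algebra.
From mathcomp Require Import ring lra.
From mathcomp Require Import all_classical all_reals all_analysis.

Set Implicit Arguments.
Unset Strict Implicit.
Unset Printing Implicit Defensive.

Import Order.TTheory GRing.Theory Num.Theory.
Import numFieldNormedType.Exports.

Local Open Scope classical_set_scope.
Local Open Scope ring_scope.

(** * Circulant matrices and their commutation *)

Section Circulant.
Variables (R : comUnitRingType) (n : nat).
Implicit Types A B : 'M[R]_n.+1.

(* Row and column indices are added modulo [n.+1]. *)
Definition circulant A := forall i j k : 'I_n.+1, A (i + k) (j + k) = A i j.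

(** The substitution [k -> i + j - k] turns the sum for [A *m B] into the one for [B *m A]:
    circulance gives [A i (i + j - k) = A k j] and [B (i + j - k) j = B i k]. *)
Lemma circulant_comm A B : circulant A -> circulant B -> A *m B = B *m A.
Proof.
move=> cA cB; apply/matrixP=> i j; rewrite !mxE.
have reflK : involutive (fun k : 'I_n.+1 => i + j - k).
  by move=> k; rewrite opprB addrCA subrr addr0.
have subDBK (x y z : 'I_n.+1) : x + y - z + (z - y) = x.
  by rewrite addrA subrK addrK.
have addrNC (x y : 'I_n.+1) : x + (y - x) = y by rewrite addrC subrK.
rewrite (reindex_inj (inv_inj reflK)); apply: eq_bigr => k _ /=.
rewrite mulrC; congr (_ * _).
  by rewrite -(cB (i + j - k) j (k - j)) subDBK addrNC.
by rewrite -(cA i (i + j - k) (k - i)) [i + j]addrC subDBK addrNC.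
Qed.

Lemma circulantB A B : circulant A -> circulant B -> circulant (A - B).
Proof. by move=> cA cB i j k; rewrite !mxE cA cB. Qed.

Lemma circulant1 : circulant 1%:M.
Proof. by move=> i j k; rewrite !mxE (inj_eq (addIr k)). Qed.

(** Sums of ordinals wrap around modulo [n.+1], so a formula [phi] in natural indices must ignore
    multiples of [n.+1]. Periodicity in the second index follows from that in the first and the
    diagonal shift. The diagonal value [d] is kept apart, as in [D1] and [D2]. *)
Lemma circulant_periodic A (d : R) (phi : nat -> nat -> R) :
    (forall j l, phi (j + n.+1)%N l = phi j l) ->
    (forall j l k, phi (j + k)%N (l + k)%N = phi j l) ->
    (forall i j, A i j = if i == j then d else phi i j) ->
  circulant A.
Proof.
move=> phiN phiD AE i j k; rewrite !AE (inj_eq (addIr k)); case: eqP => // _.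
have phiNr j' l : phi j' (l + n.+1)%N = phi j' l by rewrite -phiN phiD.
have phi_mod q j' l : phi (j' + q * n.+1)%N l = phi j' l.
  by elim: q j' => [|q IH] j'; rewrite ?addn0// mulSn addnA addnAC phiN IH.
have phi_modr q j' l : phi j' (l + q * n.+1)%N = phi j' l.
  by elim: q l => [|q IH] l; rewrite ?addn0// mulSn addnA addnAC phiNr IH.
have phi_modn x y : phi (x %% n.+1)%N (y %% n.+1)%N = phi x y.
  by rewrite [in RHS](divn_eq x n.+1) [in RHS](divn_eq y n.+1)
             ![(_ * n.+1 + _)%N]addnC phi_mod phi_modr.
by rewrite -(phiD i j k) -[RHS]phi_modn.
Qed.

End Circulant.

Lemma invmx_comm (R : comUnitRingType) (n : nat) (A B : 'M[R]_n) :
  A *m B = B *m A -> invmx A *m B = B *m invmx A.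
Proof.
(* For a singular [A], [invmx A] is [A] by convention, and the claim is then the hypothesis. *)
move=> AB; have [uA|nuA] := boolP (A \in unitmx); last by rewrite invmx_out.
by rewrite -[in LHS](mulmxK uA B) -AB !mulmxA mulVmx // mul1mx.
Qed.

(** * Symmetry and circulance of the differentiation matrices *)

Section DifferentiationMatrices.
Variables (R : realType) (a b : R).

Lemma cotDpi (x : R) : cot (x + pi) = cot x.
Proof. by rewrite /cot sinDpi cosDpi invrN mulrNN. Qed.

Lemma cotN (x : R) : cot (- x) = - cot x.
Proof. by rewrite /cot sinN cosN invrN mulrN. Qed.

Lemma cscDpi (x : R) : csc (x + pi) = - csc x.
Proof. by rewrite /csc sinDpi invrN. Qed.

Lemma cscN (x : R) : csc (- x) = - csc x.
Proof. by rewrite /csc sinN invrN. Qed.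

Lemma D1_tr N : (D1 a b N)^T = - D1 a b N.
Proof.
apply/matrixP=> i j; rewrite !mxE eq_sym; case: eqP => [|_]; first by rewrite oppr0.
rewrite -opprB mulNr mulrN cotN mulrN addnC.
by congr (- _).
Qed.

Lemma D2_tr N : (D2 a b N)^T = D2 a b N.
Proof.
apply/matrixP=> i j; rewrite !mxE eq_sym; case: eqP => // _.
by rewrite -[node a b N j - _]opprB mulNr mulrN cscN sqrrN (addnC j).
Qed.

Variable n : nat.
Hypotheses (ltab : a < b) (evenN : ~~ odd n.+1).

(** A shift by N nodes has length [b - a], and half of [mu * (b - a)] is [pi]: a period of [cot]
    and, up to sign, of [csc]. *)
Lemma half_angleDN j l :
  mu a b * ((node a b n.+1 (j + n.+1) - node a b n.+1 l) / 2) =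
  mu a b * ((node a b n.+1 j - node a b n.+1 l) / 2) + pi.
Proof.
have ba0 : b - a != 0 by rewrite subr_eq0 gt_eqF.
have n0 : n.+1%:R != 0 :> R by rewrite pnatr_eq0.
rewrite /mu /node /dx natrD; move: n.+1%:R n0 => N n0; field.
by rewrite ba0 n0.
Qed.

Lemma nodeDB j l k :
  node a b n.+1 (j + k) - node a b n.+1 (l + k) =
  node a b n.+1 j - node a b n.+1 l.
Proof. by rewrite /node !natrD; ring. Qed.

(** The evenness of N makes the alternating sign N-periodic. *)
Lemma signDN m : (-1) ^+ (m + n.+1) = (-1) ^+ m :> R.
Proof. by rewrite -signr_odd oddD (negbTE evenN) addbF signr_odd. Qed.

Lemma D1_circulant : circulant (D1 a b n.+1).
Proof.
pose phi j l := 2^-1 * mu a b * (-1) ^+ (j + l)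
  * cot (mu a b * ((node a b n.+1 j - node a b n.+1 l) / 2)).
apply: (@circulant_periodic _ _ _ 0 phi) => [j l|j l k|i j]; last by rewrite mxE.
  by rewrite /phi half_angleDN cotDpi addnAC signDN.
by rewrite /phi nodeDB addnACA addnn -signr_odd oddD odd_double addbF signr_odd.
Qed.

Lemma D2_circulant : circulant (D2 a b n.+1).
Proof.
pose phi j l := 2^-1 * mu a b ^+ 2 * (-1) ^+ (j + l + 1)
  * csc (mu a b * ((node a b n.+1 j - node a b n.+1 l) / 2)) ^+ 2.
apply: (@circulant_periodic _ _ _ (- (mu a b ^+ 2 * ((n.+1%:R ^+ 2 + 2) / 12))) phi) => [j l|j l k|i j]; last by rewrite mxE.
  by rewrite /phi half_angleDN cscDpi sqrrN [(j + n.+1 + l)%N]addnAC addnAC signDN.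
rewrite /phi nodeDB [(j + k + _)%N]addnACA addnn addnAC -signr_odd oddD odd_double.
by rewrite addbF signr_odd.
Qed.

Lemma D_tr : (D a b n.+1)^T = - D a b n.+1.
Proof.
rewrite /D trmx_mul trmx_inv D1_tr linearB /= trmx1 D2_tr mulNmx.
rewrite -invmx_comm //; apply: circulant_comm; last exact: D1_circulant.
by apply: circulantB; [exact: circulant1|exact: D2_circulant].
Qed.

End DifferentiationMatrices.

(** * The discrete inner product *)

Section InnerProduct.
Variables (R : realType) (a b : R) (N : nat).
Implicit Types (u v w : 'cV[R]_N) (A : 'M[R]_N).

Lemma innerE u v : inner a b u v = dx a b N * (u^T *m v) 0 0.
Proof. by rewrite mxE; congr (_ * _); apply: eq_bigr => i _; rewrite mxE. Qed.

Lemma innerC u v : inner a b u v = inner a b v u.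
Proof. by congr (_ * _); apply: eq_bigr => i _; rewrite mulrC. Qed.

Lemma innerDl u v w : inner a b (u + v) w = inner a b u w + inner a b v w.
Proof. by rewrite !innerE linearD mulmxDl mxE mulrDr. Qed.

Lemma innerNl u v : inner a b (- u) v = - inner a b u v.
Proof. by rewrite !innerE linearN mulNmx mxE mulrN. Qed.

Lemma innerZl k u v : inner a b (k *: u) v = k * inner a b u v.
Proof. by rewrite !innerE linearZ /= -scalemxAl mxE mulrCA. Qed.

Lemma inner_mull A u v : inner a b (A *m u) v = inner a b u (A^T *m v).
Proof. by rewrite !innerE trmx_mul mulmxA. Qed.

(** Moving [A] to the other side shows that the value equals its own opposite. *)
Lemma inner_skew A u : A^T = - A -> inner a b u (A *m u) = 0.
Proof.
move=> AT; have := inner_mull A u u.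
rewrite AT mulNmx (innerC u) innerNl innerC; lra.
Qed.

(** A difference of two squares for quadratic forms: the cross terms cancel by symmetry of [A]. *)
Lemma inner_sym_diff A u v : A^T = A ->
  inner a b (A *m u) u - inner a b (A *m v) v = inner a b (A *m (u + v)) (u - v).
Proof.
move=> AT.
have sAC x y : inner a b (A *m x) y = inner a b (A *m y) x.
  by rewrite inner_mull AT innerC.
rewrite mulmxDr innerDl !(innerC _ (u - v)) !innerDl !innerNl.
rewrite !(innerC u) !(innerC v) (sAC u v); ring.
Qed.

Lemma cvg_inner (T : Type) (F : set_system T) {FF : Filter F}
    (f g : T -> 'cV[R]_N) u v :
    (forall i, f s i 0 @[s --> F] --> u i 0) ->
    (forall i, g s i 0 @[s --> F] --> v i 0) ->
  inner a b (f s) (g s) @[s --> F] --> inner a b u v.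
Proof.
move=> fu gv; apply: cvgM; first exact: cvg_cst.
by apply: cvg_big => [|i _]; [exact: add_continuous|exact: cvgM].
Qed.

Lemma cvg_mulmx_coord (T : Type) (F : set_system T) {FF : Filter F}
    A (f : T -> 'cV[R]_N) u :
    (forall i, f s i 0 @[s --> F] --> u i 0) ->
  forall i, (A *m f s) i 0 @[s --> F] --> (A *m u) i 0.
Proof.
move=> fu i; under eq_cvg do rewrite mxE.
rewrite mxE; apply: cvg_big => [|k _]; first exact: add_continuous.
by apply: cvgM; [exact: cvg_cst|exact: fu].
Qed.

End InnerProduct.

(** * Derivatives relative to a set *)

Section DerivativeOnASetTheory.
Variables (R : realType).

(** Properness makes limits unique, so that a computed limit is the value of [deriv_on]. It holds
    because an interval of positive length has no isolated point. *)
Lemma proper_within_itv (T t : R) : 0 < T -> t \in `[0, T] ->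
  ProperFilter (within `[0, T] t^').
Proof.
move=> T0 /[!in_itv]/= /andP[t0 tT]; apply: Build_ProperFilter_ex => P.
move=> /nbhs_ballP[e /= e0 eP].
have near_t s : `|t - s| < e -> s != t -> 0 <= s <= T -> P s.
  by move=> tse st sT; apply: eP => //=; rewrite in_itv.
have [tltT|Tlet] := ltP t T.
  (* The bound [e / 2] keeps the point in the open ball, the bound [T - t] in the interval. At the
     right endpoint the step goes left instead. *)
  exists (t + Num.min (e / 2) (T - t)); apply: near_t.
  - by rewrite opprD addNKr normrN; case: (leP (e / 2)) => ?; rewrite ger0_norm; lra.
  - by rewrite -subr_eq0 addrAC subrr add0r gt_eqF// lt_min; lra.
  - by case: (leP (e / 2)) => ?; lra.
exists (t - Num.min (e / 2) T); apply: near_t.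
- by rewrite opprB addrCA subrr addr0; case: (leP (e / 2)) => ?; rewrite ger0_norm; lra.
- by rewrite -subr_eq0 addrAC subrr add0r oppr_eq0 gt_eqF// lt_min; lra.
- by case: (leP (e / 2)) => ?; lra.
Qed.

(** At [s = t] the quotient is multiplied by 0, so the expansion is exact for every [s] and can be
    rewritten under a limit. *)
Lemma diff_quotientK (V : normedModType R) (f : R -> V) (t s : R) :
  f s = f t + (s - t) *: diff_quotient f t s.
Proof.
rewrite /diff_quotient scalerA; have [->|st] := eqVneq s t.
  by rewrite subrr mul0r scale0r addr0.
by rewrite divff ?subr_eq0// scale1r addrC subrK.
Qed.

Lemma derivable_on_continuous (V : normedModType R) (A : set R) (f : R -> V) t :
  derivable_on A f t -> f s @[s --> within A t^'] --> f t.
Proof.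
move=> df; rewrite -[X in _ --> X]addr0 -[X in _ + X](scale0r (deriv_on A f t)).
under eq_cvg do rewrite (diff_quotientK f t).
apply: cvgD; first exact: cvg_cst.
apply: cvgZ; last exact: df.
rewrite -[X in _ --> X](subrr t).
apply: cvgB; last exact: cvg_cst.
(* The filter is the neighbourhood filter of [t] restricted twice: to points other than [t], then to
   [A]. *)
by do 2! apply: cvg_within_filter; exact: cvg_id.
Qed.

Lemma cvg_diff_quotient_sqr (A : set R) (q : R -> R) t : derivable_on A q t ->
  diff_quotient (fun s => q s ^+ 2) t s @[s --> within A t^'] -->
    2 * q t * deriv_on A q t.
Proof.
move=> dq; have qE s : diff_quotient (fun s => q s ^+ 2) t s =
    (q s + q t) * diff_quotient q t s.
  by rewrite /diff_quotient /GRing.scale/=; ring.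
under eq_cvg do rewrite qE.
rewrite mulr_natl mulr2n; apply: cvgM; last exact: dq.
by apply: cvgD; [exact: derivable_on_continuous|exact: cvg_cst].
Qed.

(** By [inner_sym_diff] the quotient is bilinear in [U s + U t] and the quotient of [U], so
    continuity and derivability of [U] at [t] give the limit. *)
Lemma cvg_diff_quotient_inner (a b : R) (N : nat) (M : 'M[R]_N) (A : set R)
    (U : R -> 'cV[R]_N) t : M^T = M -> derivable_on A U t ->
  diff_quotient (fun s => inner a b (M *m U s) (U s)) t s
    @[s --> within A t^'] --> 2 * inner a b (M *m U t) (deriv_on A U t).
Proof.
move=> MT dU; have QE s : diff_quotient (fun s => inner a b (M *m U s) (U s)) t s =
    inner a b (M *m (U s + U t)) (diff_quotient U t s).
  by rewrite /diff_quotient inner_sym_diff // [RHS]innerC innerZl innerC.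
have coord (f : R -> 'cV[R]_N) (u : 'cV[R]_N) : f s @[s --> within A t^'] --> u ->
    forall i, f s i 0 @[s --> within A t^'] --> u i 0.
  move=> fu i; apply: (@cvg_comp _ _ _ f (fun w : 'cV[R]_N => w i 0) _ _ _ fu).
  exact: coord_continuous.
under eq_cvg do rewrite QE.
rewrite mulr_natl mulr2n -innerDl -mulmxDr; apply: cvg_inner.
  apply: cvg_mulmx_coord; apply: coord.
  by apply: cvgD; [exact: derivable_on_continuous|exact: cvg_cst].
exact/coord/dU.
Qed.

End DerivativeOnASetTheory.

(** * Conservation of the modified energy *)

Theorem theorem3p1 (R : realType) (a b T C1 C2 : R) (N : nat)
  (U : R -> 'cV[R]_N) (q1 q2 : R -> R) :
  a < b -> (0 < N)%N -> ~~ odd N -> 0 < T ->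
  (forall t, t \in `[0, T] -> 0 < radicand a b g C1 (U t)) ->
  (forall t, t \in `[0, T] -> 0 < radicand a b h C2 (U t)) ->
  continuously_derivable_on `[0, T] U ->
  continuously_derivable_on `[0, T] q1 ->
  continuously_derivable_on `[0, T] q2 ->
  (forall t, t \in `[0, T] ->
    deriv_on `[0, T] U t =
      D a b N *m
        (- (q1 t *: sav_gradient a b g g1 g2 C1 (U t))
         + q2 t *: sav_gradient a b h h1 h2 C2 (U t)
         + 4^-1 *: (U t - D2 a b N *m U t))) ->
  (forall t, t \in `[0, T] ->
    deriv_on `[0, T] q1 t =
      inner a b (sav_gradient a b g g1 g2 C1 (U t))
                (deriv_on `[0, T] U t)) ->
  (forall t, t \in `[0, T] ->
    deriv_on `[0, T] q2 t =
      inner a b (sav_gradient a b h h1 h2 C2 (U t))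
                (deriv_on `[0, T] U t)) ->
  forall t, t \in `[0, T] ->
    derivable_on `[0, T] (fun s => energy a b C1 C2 (U s) (q1 s) (q2 s)) t /\
    deriv_on `[0, T] (fun s => energy a b C1 C2 (U s) (q1 s) (q2 s)) t = 0.
Proof.
(* Writing N as [n.+1] makes the indices a cyclic group, as circulance requires. *)
move=> ltab; case: N U => // n {}U _ evenN T0 _ _ [dU _] [dq1 _] [dq2 _].
move=> UE q1E q2E t tT.
have FF := proper_within_itv T0 tT.
have {dU} dU := dU t tT; have {dq1} dq1 := dq1 t tT; have {dq2} dq2 := dq2 t tT.
have symM : (1%:M - D2 a b n.+1)^T = 1%:M - D2 a b n.+1.
  by rewrite linearB /= trmx1 D2_tr.
have mulM V : (1%:M - D2 a b n.+1) *m V = V - D2 a b n.+1 *m V.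
  by rewrite mulmxBl mul1mx.
set E := fun s => energy a b C1 C2 (U s) (q1 s) (q2 s).
(* The constant terms in [C1] and [C2] cancel in the difference. *)
have EE s : diff_quotient E t s =
    8^-1 * diff_quotient (fun s => inner a b ((1%:M - D2 a b n.+1) *m U s) (U s)) t s
    - 2^-1 * diff_quotient (fun s => q1 s ^+ 2) t s
    + 2^-1 * diff_quotient (fun s => q2 s ^+ 2) t s.
  by rewrite /diff_quotient /E /energy !mulM /GRing.scale/=; ring.
suff E0 : diff_quotient E t s @[s --> within `[0, T] t^'] --> (0 : R).
  by split; [apply/cvg_ex; exists 0|exact: cvg_lim].
(* [G] is the vector to which [D] is applied in the equation for [U]; skew-symmetry of [D] makes it
   orthogonal to [D *m G], the derivative of [U]. *)
pose G := - (q1 t *: sav_gradient a b g g1 g2 C1 (U t))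
  + q2 t *: sav_gradient a b h h1 h2 C2 (U t)
  + 4^-1 *: (U t - D2 a b n.+1 *m U t).
have GU : inner a b G (deriv_on `[0, T] U t) = 0.
  by rewrite UE // inner_skew // D_tr.
have innerG (x y z : R) (X Y Z V : 'cV[R]_n.+1) :
    inner a b (- (x *: X) + y *: Y + z *: Z) V =
    - (x * inner a b X V) + y * inner a b Y V + z * inner a b Z V.
  by rewrite !innerDl innerNl !innerZl.
(* The factors 2 from differentiating squares turn the weights 1/8 and 1/2 into the coefficients 1/4
   and 1 of [G]. With the equations for [q1] and [q2], the left side is the inner product of [G]
   with the derivative of [U]. *)
have dE0 :
    8^-1 * (2 * inner a b ((1%:M - D2 a b n.+1) *m U t) (deriv_on `[0, T] U t))
    - 2^-1 * (2 * q1 t * deriv_on `[0, T] q1 t)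
    + 2^-1 * (2 * q2 t * deriv_on `[0, T] q2 t) = 0.
  by rewrite -[RHS]GU innerG q1E // q2E // mulM; field.
rewrite -[X in _ --> X]dE0; under eq_cvg do rewrite EE.
apply: cvgD; [apply: cvgB|]; apply: cvgM; try exact: cvg_cst.
- exact: cvg_diff_quotient_inner.
- exact: cvg_diff_quotient_sqr.
- exact: cvg_diff_quotient_sqr.
Qed.
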